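(* Let $D=(E,\mathcal{F})$ be a binary delta-matroid. If the set $\{w(D*A): A\subseteq E\}$ contains two consecutive integers $k$ and $k+1$, then every integer $m$ with $k+2\le m\le w_M(D)$ belongs to $\{w(D*A): A\subseteq E\}$.
   Context: A set system is a pair $D=(E,\mathcal{F})$ with $E$ finite and $\mathcal{F}$ a collection of subsets of $E$. A delta-matroid is a set system with $\mathcal{F}\neq\emptyset$ such that for all $X,Y\in\mathcal{F}$ and $u\in X\Delta Y$ there is $v\in X\Delta Y$ (possibly $v=u$) with $X\Delta\{u,v\}\in\mathcal{F}$ ($\Delta$ = symmetric difference). The twist by $A\subseteq E$ is $D*A=(E,\{A\Delta X: X\in\mathcal{F}\})$. For a symmetric matrix $C$ over $\mathrm{GF}(2)$ indexed by $E$, $D(C)=(E,\{A\subseteq E: C[A]\text{ non-singular}\})$, with $C[A]$ the principal submatrix on $A$ and $C[\emptyset]$ non-singular by convention; a delta-matroid is binary if some twist of it is isomorphic to some $D(C)$. The width is $w(D)=\max\{|F|:F\in\mathcal{F}\}-\min\{|F|:F\in\mathcal{F}\}$, and the maximum twist width is $w_M(D)=\max\{w(D*A):A\subseteq E\}$. *)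

(* Defs.v *)
From mathcomp Require Import all_boot all_order all_algebra.
Set Implicit Arguments. Unset Strict Implicit. Unset Printing Implicit Defensive.
Import GRing.Theory.
Local Open Scope ring_scope.

Definition symdiff (T : finType) (X Y : {set T}) : {set T} := (X :\: Y) :|: (Y :\: X).

Definition is_delta_matroid (E : finType) (F : {set {set E}}) : Prop :=
  F != set0 /\
  forall X Y, X \in F -> Y \in F -> forall u, u \in symdiff X Y ->
    exists2 v, v \in symdiff X Y & symdiff X [set u; v] \in F.

Definition twist (E : finType) (F : {set {set E}}) (A : {set E}) : {set {set E}} :=
  [set symdiff A X | X in F].

Definition principal_submx (R : nzRingType) n (C : 'M[R]_n) (A : {set 'I_n})
  : 'M[R]_#|A| := \matrix_(i, j) C (enum_val i) (enum_val j).

(* D(C): feasible sets are those A with C[A] nonsingular (C[set0] is the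
   0x0 matrix, whose determinant is 1, so it is nonsingular). *)
Definition DC n (C : 'M['F_2]_n) : {set {set 'I_n}} :=
  [set A : {set 'I_n} | principal_submx C A \in unitmx].

Definition setsys_iso (E E' : finType) (F : {set {set E}}) (F' : {set {set E'}}) : Prop :=
  exists f : E -> E', bijective f /\ forall X : {set E}, (X \in F) = (f @: X \in F').

Definition is_binary (E : finType) (F : {set {set E}}) : Prop :=
  is_delta_matroid F /\
  exists (A : {set E}) (n : nat) (C : 'M['F_2]_n),
    C^T = C /\ setsys_iso (twist F A) (DC C).

(* Width: max |F| - min |F| over feasible sets (F assumed nonempty). *)
Definition width (E : finType) (F : {set {set E}}) : nat :=
  (\max_(X in F) #|X| - \big[minn/#|E|]_(X in F) #|X|)%N.

Definition max_twist_width (E : finType) (F : {set {set E}}) : nat :=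
  \max_(A : {set E}) width (twist F A).

Definition twist_widths (E : finType) (F : {set {set E}}) : pred nat :=
  fun m => [exists A : {set E}, width (twist F A) == m].

(* Main.v *)
(* Let d(B) be the Hamming distance from B to the nearest feasible set. Then
   w(D*A) = |E| - d(A) - d(E \ A), so flipping one element changes w by at most 2.
   Suppose m is not a value of w, w(D*A) < m with w(D*A) = m mod 2, and let X be
   nearest to A among the sets with w(D*X) > m. Flipping any e in X Δ A must drop
   w from m+1 to m-1, so it increases both d(X) and d(E \ X) by one. Twist D at a
   feasible set nearest to X: the matrix representing D there has zero diagonal on
   the elements involved, so it is alternating and its nonsingular principal
   submatrices have even size. Hence d(X Δ P) = d(X) + |P| mod 2 for all
   P included in X Δ A, and likewise for E \ X; taking P = X Δ A gives
   w(D*A) = w(D*X) = m+1 mod 2, a contradiction. *)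
Require Import Defs.
From mathcomp Require Import all_boot all_order all_algebra.
From mathcomp Require Import zify.
Set Implicit Arguments. Unset Strict Implicit. Unset Printing Implicit Defensive.
Import Order.TTheory GRing.Theory Num.Theory.

(** * Symmetric difference: algebra and cardinalities *)

Section SymmetricDifference.
Variable E : finType.
Implicit Types (A B X Y Z : {set E}) (x u v : E).

Lemma in_symdiff X Y x : (x \in symdiff X Y) = (x \in X) (+) (x \in Y).
Proof. by rewrite !inE; case: (x \in X); case: (x \in Y). Qed.

Lemma symdiffC X Y : symdiff X Y = symdiff Y X.
Proof. by apply/setP => x; rewrite !in_symdiff addbC. Qed.

Lemma symdiffA X Y Z : symdiff X (symdiff Y Z) = symdiff (symdiff X Y) Z.
Proof. by apply/setP => x; rewrite !in_symdiff addbA. Qed.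

Lemma symdiffK X Y : symdiff X (symdiff X Y) = Y.
Proof. by apply/setP => x; rewrite !in_symdiff addKb. Qed.

Lemma symdiff_setC X Y : symdiff (~: X) Y = ~: symdiff X Y.
Proof. by apply/setP => x; rewrite in_setC !in_symdiff in_setC addNb. Qed.

Lemma symdiff1_in X u : u \in X -> symdiff X [set u] = X :\ u.
Proof.
move=> uX; apply/setP => x; rewrite in_symdiff !inE.
by case: eqVneq => [->|_]; rewrite ?uX // addbF.
Qed.

Lemma symdiff1_notin X u : u \notin X -> symdiff X [set u] = u |: X.
Proof.
move=> uX; apply/setP => x; rewrite in_symdiff !inE.
by case: eqVneq => [->|_]; rewrite ?(negPf uX) // addbF.
Qed.

Lemma set2_symdiff u v : u != v -> [set u; v] = symdiff [set u] [set v].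
Proof.
move=> uv; apply/setP => x; rewrite in_symdiff !inE.
by case: (eqVneq x u) => [->|//]; rewrite (negPf uv).
Qed.

Lemma card_symdiff1_in X u : u \in X -> #|symdiff X [set u]|.+1 = #|X|.
Proof. by move=> uX; rewrite symdiff1_in // [RHS](cardsD1 u) uX. Qed.

Lemma card_symdiff1_notin X u : u \notin X -> #|symdiff X [set u]| = #|X|.+1.
Proof. by move=> uX; rewrite symdiff1_notin // cardsU1 uX. Qed.

Lemma card_symdiff1_le X u : #|symdiff X [set u]| <= #|X|.+1.
Proof.
have [uX|uX] := boolP (u \in X); last by rewrite card_symdiff1_notin.
by have := card_symdiff1_in uX; lia.
Qed.

Lemma odd_card_symdiff X Y : odd #|symdiff X Y| = odd #|X| (+) odd #|Y|.
Proof.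
rewrite /symdiff cardsU.
have -> : (X :\: Y) :&: (Y :\: X) = set0.
  by apply/setP => x; rewrite !inE; case: (x \in X); case: (x \in Y).
rewrite cards0 subn0 oddD -(cardsID Y X) -(cardsID X Y) setIC !oddD.
by case: (odd #|Y :&: X|); case: (odd _); case: (odd _).
Qed.

End SymmetricDifference.

Lemma imset_symdiff (E E' : finType) (f : E -> E') (X Y : {set E}) : bijective f ->
  f @: symdiff X Y = symdiff (f @: X) (f @: Y).
Proof.
move=> fB; have fI := bij_inj fB; have [g _ gK] := fB; apply/setP => y.
by rewrite in_symdiff -(gK y) !(mem_imset _ _ fI) in_symdiff.
Qed.

(** * Distance to the nearest feasible set, and widths of twists *)

Section Distance.
Variables (E : finType) (F : {set {set E}}).
Implicit Types (A B X Y P : {set E}).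

Definition feasible_dist B : nat := \big[minn/#|E|]_(X in F) #|symdiff B X|.

Lemma feasible_dist_le B X : X \in F -> feasible_dist B <= #|symdiff B X|.
Proof. exact: (@bigmin_le_cond _ nat). Qed.

Hypothesis F0 : F != set0.

Lemma feasible_dist_attained B :
  exists2 X, X \in F & #|symdiff B X| = feasible_dist B.
Proof.
have [X0 X0F] := set0Pn _ F0.
have [|X XF eX] := @eq_bigmin _ nat _ #|E| X0 (mem F) (fun X => #|symdiff B X|) X0F.
  by move=> X _; apply: max_card.
by exists X.
Qed.

Lemma feasible_dist_step B e :
  feasible_dist (symdiff B [set e]) <= (feasible_dist B).+1.
Proof.
have [X XF <-] := feasible_dist_attained B.
apply: leq_trans (feasible_dist_le _ XF) _.
by rewrite symdiffC symdiffA (symdiffC X) card_symdiff1_le.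
Qed.

(** Complementing [A] complements every [symdiff A X], so the largest feasible set of the twist has
    size [#|E|] minus the distance from [~: A], while the smallest has size the distance from
    [A]. *)
Lemma width_twist A :
  width (twist F A) + feasible_dist A + feasible_dist (~: A) = #|E|.
Proof.
have EA X : #|symdiff A X| + #|symdiff (~: A) X| = #|E|.
  by rewrite symdiff_setC cardsC.
have [X XF eX] := feasible_dist_attained A.
have [Y YF eY] := feasible_dist_attained (~: A).
have maxE : \max_(Z in twist F A) #|Z| = #|symdiff A Y|.
  apply/eqP; rewrite eqn_leq; apply/andP; split.
    apply/bigmax_leqP => _ /imsetP [Z ZF ->].
    by have := feasible_dist_le (~: A) ZF; have := EA Z; have := EA Y; lia.
  by apply: (bigop.bigmax_sup (symdiff A Y)) => //; apply: imset_f.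
have minE : \big[minn/#|E|]_(Z in twist F A) #|Z| = feasible_dist A.
  exact: (@bigmin_imset _ nat).
have := feasible_dist_le A YF; have := EA Y.
rewrite /width maxE minE; lia.
Qed.

Hypothesis exchange : forall X Y, X \in F -> Y \in F -> forall u, u \in symdiff X Y ->
    exists2 v, v \in symdiff X Y & symdiff X [set u; v] \in F.

(* Exchanging a nearest feasible set towards Y at an element outside B Δ Y
   keeps it nearest to B and brings it closer to Y. *)
Lemma nearest_feasible_sub B Y : Y \in F ->
  exists2 X, X \in F & #|symdiff B X| = feasible_dist B /\
                       symdiff Y X \subset symdiff B Y.
Proof.
move=> YF; have [X0 X0F eX0] := feasible_dist_attained B.
pose nearest := [pred X in F | #|symdiff B X| == feasible_dist B].
have X0n : nearest X0 by rewrite /nearest /= X0F eX0 /=.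
case: (arg_minnP (fun X => #|symdiff Y X|) X0n) => X /andP [/= XF /eqP eX] minX.
exists X => //; split => //; apply/subsetP => u uYX; apply: contraT => uBY.
have uBX : u \in symdiff B X.
  by move: uYX uBY; rewrite !in_symdiff; do 3!case: (_ \in _).
have [v vXY WF] := exchange XF YF (u := u) ltac:(by rewrite symdiffC).
have [uv|uv] := eqVneq u v.
  (* If [v = u], the exchange only removes [u] from [symdiff B X], giving a feasible set too near to
     [B]. *)
  have := feasible_dist_le B WF.
  rewrite -uv setUid symdiffA -eX => le.
  by have := card_symdiff1_in uBX; lia.
have c1 := card_symdiff1_in uBX; have c2 := card_symdiff1_in uYX.
have vY : v \in symdiff (symdiff Y X) [set u].
  by rewrite symdiff1_in // in_setD1 eq_sym uv symdiffC.
have c3 := card_symdiff1_in vY.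
rewrite set2_symdiff // in WF.
(* Towards [B], dropping [u] gains one and flipping [v] loses at most one, so the new set is still
   nearest; towards [Y] both flips gain one, against the choice of [X]. *)
have eB := card_symdiff1_le (symdiff (symdiff B X) [set u]) v.
have dW := feasible_dist_le B WF; rewrite !symdiffA in dW.
have := minX (symdiff X (symdiff [set u] [set v])).
rewrite /nearest /= WF !symdiffA => /(_ ltac:(apply/eqP; lia)).
by lia.
Qed.

(** Binarity enters the distance arguments only here; [binary_loopless_even] discharges this by
    matrices. *)
Hypothesis loopless_even : forall Y W, Y \in F -> symdiff Y W \in F ->
  (forall q, q \in W -> symdiff Y [set q] \notin F) -> ~~ odd #|W|.

Lemma feasible_dist_parity X P :
  (forall e, e \in P -> feasible_dist (symdiff X [set e]) = (feasible_dist X).+1) ->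
  odd (feasible_dist (symdiff X P)) = odd (feasible_dist X) (+) odd #|P|.
Proof.
move=> up; have [Y YF eY] := feasible_dist_attained X.
have [Z ZF [<- sub]] := nearest_feasible_sub (symdiff X P) YF.
have even_YZ : ~~ odd #|symdiff Y Z|.
  apply: (loopless_even YF); first by rewrite symdiffK.
  move=> q /(subsetP sub); rewrite !in_symdiff => qXPY; apply/negP => YqF.
  (* For [q] in [P], feasibility of [symdiff Y [set q]] would keep [symdiff X [set q]] at distance
     at most that of [X], against [up]; for the other [q] it would be nearer to [X] than [Y] is. *)
  have [qP|qP] := boolP (q \in P).
    have := feasible_dist_le (symdiff X [set q]) YqF.
    rewrite up // -symdiffA (symdiffC Y) symdiffK eY; lia.
  have qXY : q \in symdiff X Y.
    by move: qXPY; rewrite (negPf qP) addbF in_symdiff.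
  have := feasible_dist_le X YqF; rewrite symdiffA -eY.
  by have := card_symdiff1_in qXY; lia.
move: even_YZ; rewrite -eY !odd_card_symdiff.
by do 4!case: (odd _).
Qed.

Lemma width_twist_no_gap m A X0 :
  width (twist F A) < m -> odd (width (twist F A)) = odd m ->
  m < width (twist F X0) -> exists B, width (twist F B) = m.
Proof.
move=> Am Aodd mX0.
have [/existsP [B /eqP] |/existsPn gap] :=
  boolP [exists B, width (twist F B) == m]; first by exists B.
pose above := [pred X | m < width (twist F X)].
have X0a : above X0 by [].
case: (arg_minnP (fun X => #|symdiff X A|) X0a) => X /= mX minX.
have drop e : e \in symdiff X A -> [/\ width (twist F X) = m.+1,
    feasible_dist (symdiff X [set e]) = (feasible_dist X).+1 &
    feasible_dist (symdiff (~: X) [set e]) = (feasible_dist (~: X)).+1].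
  move=> eXA; have := width_twist X; have := width_twist (symdiff X [set e]).
  have := feasible_dist_step X e; have := feasible_dist_step (~: X) e.
  rewrite symdiff_setC; have /eqP := gap (symdiff X [set e]).
  (* Flipping [e] moves [X] closer to [A], so minimality forbids a width above [m]. As [m] itself is
     skipped and each distance grows by at most one, the width falls by exactly two. *)
  have : ~~ (m < width (twist F (symdiff X [set e]))).
    apply/negP => /minX; rewrite -symdiffA (symdiffC [set e]) symdiffA.
    by have := card_symdiff1_in eXA; lia.
  by move=> ??????; split; lia.
(* An element to flip is needed to extract the width [m.+1] of [X] from [drop]. *)
have [e eXA] : exists e, e \in symdiff X A.
  apply/set0Pn/negP => /eqP XA0.
  have XA : A = X by rewrite -(symdiffK X A) XA0 /symdiff setD0 set0D setU0.
  by rewrite XA in Am; lia.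
have [wX _ _] := drop e eXA.
have pA : odd (feasible_dist A) = odd (feasible_dist X) (+) odd #|symdiff X A|.
  by rewrite -feasible_dist_parity ?symdiffK // => e' /drop [].
have pAC : odd (feasible_dist (~: A)) =
    odd (feasible_dist (~: X)) (+) odd #|symdiff X A|.
  rewrite -feasible_dist_parity ?symdiff_setC ?symdiffK // => e' /drop [_ _].
  by rewrite symdiff_setC.
(* The parity of [symdiff X A] enters through both distances and cancels. *)
have := congr1 odd (width_twist A); have := congr1 odd (width_twist X).
rewrite !oddD pA pAC Aodd wX /=.
by do 5!case: (odd _).
Qed.

End Distance.

(** * Symmetric matrices over GF(2) with zero diagonal *)

Local Open Scope ring_scope.

Lemma F2_addxx (x : 'F_2) : x + x = 0.
Proof. by case: x => [[|[|]]] //= ?; apply/val_inj. Qed.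

(* A symmetric matrix over 'F_2 with zero diagonal lifts to a skew-symmetric
   integer matrix, whose determinant vanishes in odd dimension. *)
Lemma odd_hollow_nonunit n (A : 'M['F_2]_n) :
  A^T = A -> (forall i, A i i = 0) -> odd n -> A \notin unitmx.
Proof.
move=> AT A0 n_odd.
pose B : 'M[int]_n := \matrix_(i, j)
  (if (i < j)%N then (val (A i j))%:Z else if (j < i)%N then - (val (A i j))%:Z else 0).
have AB : A = map_mx intr B.
  apply/matrixP => i j; rewrite !mxE.
  have Aij : (val (A i j))%:R = A i j by apply: natr_Zp.
  have [_|_|ij] := ltngtP i j.
  - by rewrite -pmulrn Aij.
  - by rewrite mulrNz -pmulrn Aij; apply/eqP; rewrite -subr_eq0 opprK F2_addxx.
  - by rewrite (val_inj ij) A0.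
have BT : B^T = - B.
  apply/matrixP => i j; rewrite !mxE.
  have -> : A j i = A i j by rewrite -[in RHS]AT mxE.
  by case: ltngtP => _; rewrite ?opprK ?oppr0.
(* Over the integers a determinant equal to its opposite is zero; over ['F_2] the same equation
   would say nothing. *)
have detB : \det B = 0.
  have := det_tr B; rewrite BT -scaleN1r detZ -signr_odd n_odd expr1 mulN1r => /eqP.
  by rewrite eqNr => /eqP.
by rewrite unitmxE AB det_map_mx detB rmorph0 unitr0.
Qed.

(** * Principal submatrices and pivoting *)

Section PrincipalPivot.
Variable R : fieldType.

(** Working at full size avoids principal submatrices whose dimension depends on the index set. *)
Definition select_rows m n (Y : {set 'I_m}) (A B : 'M[R]_(m, n)) : 'M[R]_(m, n) :=
  \matrix_(i, j) if i \in Y then A i j else B i j.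

Lemma select_rowsM m n p (Y : {set 'I_m}) (A B : 'M[R]_(m, n)) (D : 'M_(n, p)) :
  select_rows Y A B *m D = select_rows Y (A *m D) (B *m D).
Proof.
apply/matrixP => i j; rewrite !mxE; case: ifP => iY;
  by apply: eq_bigr => k _; rewrite mxE iY.
Qed.

Lemma select_rows_symdiff m n (Y W : {set 'I_m}) (A B : 'M[R]_(m, n)) :
  select_rows (symdiff Y W) A B = select_rows W (select_rows Y B A) (select_rows Y A B).
Proof.
by apply/matrixP => i j; rewrite !mxE !inE; case: (i \in Y); case: (i \in W).
Qed.

(** Up to reordering, the full-size matrix is block triangular with diagonal blocks [C[A]] and an
    identity. Left kernel vectors are restricted to [A] in one direction and extended from [A] in
    the other. *)
Lemma principal_unitmx n (C : 'M[R]_n) (A : {set 'I_n}) :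
  (principal_submx C A \in unitmx) = (select_rows A C 1%:M \in unitmx).
Proof.
rewrite -!row_free_unit.
have mulE (v : 'rV_n) j : (v *m select_rows A C 1%:M) 0 j =
    \sum_(i in A) v 0 i * C i j + (if j \in A then 0 else v 0 j).
  rewrite mxE (bigID (mem A)) /=; congr (_ + _).
    by apply: eq_bigr => i iA; rewrite mxE iA.
  case: ifP => jA.
    rewrite big1 // => i iA; rewrite mxE (negPf iA) mxE.
    by case: eqP iA => [->|_ _]; rewrite ?jA // mulr0.
  rewrite (bigD1 j) ?jA //= mxE jA mxE eqxx mulr1 big1 ?addr0 // => i /andP [iA ij].
  by rewrite mxE (negPf iA) mxE (negPf ij) mulr0.
have sumE (v : 'rV_n) (u : 'rV_#|A|) : (forall k, u 0 k = v 0 (enum_val k)) ->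
    forall k, (u *m principal_submx C A) 0 k = \sum_(i in A) v 0 i * C i (enum_val k).
  move=> uv k; rewrite big_enum_val mxE.
  by apply: eq_bigr => i _; rewrite mxE uv.
apply/idP/idP => free; apply: inj_row_free.
  move=> v /matrixP v0.
  pose u : 'rV_#|A| := \row_k v 0 (enum_val k).
  have u0 : u = 0.
    apply/eqP; rewrite -(mulmx_free_eq0 _ free); apply/eqP/matrixP => i k.
    rewrite ord1 (sumE v) => [|l]; last by rewrite mxE.
    by have := v0 0 (enum_val k); rewrite mulE enum_valP addr0 !mxE.
  have vA i : i \in A -> v 0 i = 0.
    move=> iA; rewrite -(enum_rankK_in iA iA).
    by move/matrixP: u0 => /(_ 0 (enum_rank_in iA i)); rewrite !mxE.
  apply/matrixP => i j; rewrite ord1 [RHS]mxE.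
  have [/vA //|jA] := boolP (j \in A).
  have := v0 0 j; rewrite mulE (negPf jA) big1 ?add0r ?mxE // => l /vA ->.
  by rewrite mul0r.
move=> u u0.
pose w i : R := if [pick k | enum_val k == i] is Some k then u 0 k else 0.
have wE (k : 'I_#|A|) : w (enum_val k) = u 0 k.
  rewrite /w; case: pickP => [l /eqP /enum_val_inj -> //|/(_ k)].
  by rewrite eqxx.
(* Off [A] the entry is forced: it must cancel what the rows of [C] contribute to column [j]. *)
pose v : 'rV_n := \row_j if j \in A then w j else - \sum_(i in A) w i * C i j.
have vA i : i \in A -> v 0 i = w i by move=> iA; rewrite mxE iA.
have v0 : v = 0.
  apply/eqP; rewrite -(mulmx_free_eq0 _ free); apply/eqP/matrixP => i j.
  rewrite ord1 mulE [RHS]mxE; case: ifP => jA; last first.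
    rewrite [v 0 j]mxE jA (eq_bigr (fun i => w i * C i j)) ?subrr // => l lA.
    by rewrite vA.
  rewrite addr0 -(enum_rankK_in jA jA) -(sumE v u) ?u0 ?mxE // => k.
  by rewrite vA ?enum_valP // wE.
by apply/matrixP => i k; rewrite ord1 -wE -vA ?enum_valP // v0 !mxE.
Qed.

Lemma principal_unitmx1 n (C : 'M[R]_n) (q : 'I_n) :
  C q q != 0 -> principal_submx C [set q] \in unitmx.
Proof.
move=> Cq; rewrite -row_free_unit; apply: inj_row_free => v /matrixP v0.
have one (k : 'I_#|[set q]|) : enum_val k = q by apply/set1P/enum_valP.
apply/matrixP => i k; rewrite ord1 [RHS]mxE.
have := v0 0 k; rewrite !mxE (bigD1 k) //= big1 => [|l /eqP []]; last first.
  by apply: enum_val_inj; rewrite !one.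
by rewrite mxE !one addr0 => /eqP; rewrite mulf_eq0 (negPf Cq) orbF => /eqP.
Qed.

(* Principal pivot transform, up to the signs needed in odd characteristic. *)
Definition pivot n (C : 'M[R]_n) (Y : {set 'I_n}) : 'M[R]_n :=
  select_rows Y 1%:M C *m invmx (select_rows Y C 1%:M).

(** Right multiplication by the invertible [select_rows Y C 1%:M] turns the row selection for [W] in
    the pivot into the one for [symdiff Y W] in [C]. *)
Lemma pivot_unitmx n (C : 'M[R]_n) (Y W : {set 'I_n}) :
  principal_submx C Y \in unitmx ->
  (principal_submx (pivot C Y) W \in unitmx) =
  (principal_submx C (symdiff Y W) \in unitmx).
Proof.
rewrite !principal_unitmx => YU.
rewrite select_rows_symdiff.
have -> : select_rows W (select_rows Y 1%:M C) (select_rows Y C 1%:M) =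
   select_rows W (pivot C Y) 1%:M *m select_rows Y C 1%:M.
  by rewrite select_rowsM mulmxKV // mul1mx.
by rewrite unitmx_mul YU andbT.
Qed.

End PrincipalPivot.

(** With the pivot written as [Q *m invmx P], it suffices that [P^T *m Q] be symmetric. Its entries
    at [(i, j)] and [(j, i)] differ by an even multiple of [C i j], which vanishes in characteristic
    2. *)
Lemma pivot_sym n (C : 'M['F_2]_n) (Y : {set 'I_n}) :
  C^T = C -> principal_submx C Y \in unitmx -> (pivot C Y)^T = pivot C Y.
Proof.
rewrite principal_unitmx /pivot => CT YU.
set P := select_rows Y C _ in YU *; set Q := select_rows _ _ _.
have PQ i j : (P^T *m Q) i j = C i j *+ (j \in Y) + C i j *+ (i \notin Y).
  rewrite mxE (bigID (mem Y)) /=; congr (_ + _).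
    rewrite (eq_bigr (fun k => if k == j then C i j else 0)) => [|k kY].
      rewrite -big_mkcondr /=; have [jY|jY] := boolP (j \in Y).
        by rewrite (big_pred1 j) // => k /=; case: eqP => [->|]; rewrite ?jY ?andbF ?eqxx.
      by rewrite big_pred0 // => k /=; case: eqP => [->|]; rewrite ?(negPf jY) ?andbF ?eqxx.
    rewrite !mxE kY; case: eqP => [->|_]; rewrite ?mulr0 ?mulr1 //.
    by rewrite -[in LHS]CT mxE.
  rewrite (eq_bigr (fun k => if k == i then C i j else 0)) => [|k kY].
    rewrite -big_mkcondr /=; have [iY|iY] := boolP (i \in Y).
      by rewrite big_pred0 // => k /=; case: eqP => [->|]; rewrite ?iY ?andbF ?eqxx.
    by rewrite (big_pred1 i) // => k /=; case: eqP => [->|]; rewrite ?iY ?andbF ?eqxx.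
  rewrite !mxE (negPf kY); case: eqP => [->|_]; by rewrite ?mul0r ?mul1r.
have sym : P^T *m Q = Q^T *m P.
  rewrite -[Q^T *m P]trmxK trmx_mul trmxK; apply/matrixP => i j.
  rewrite [RHS]mxE !PQ.
  have -> : C j i = C i j by rewrite -[in RHS]CT mxE.
  case: (i \in Y); case: (j \in Y); rewrite /= ?F2_addxx ?addr0 ?add0r //.
rewrite trmx_mul trmx_inv -[Q in RHS](mulKmx (x := P^T)) ?unitmx_tr // sym.
by rewrite -!mulmxA mulmxV // mulmx1.
Qed.

(** A nonzero diagonal entry of the pivot at [q] in [W] would make [symdiff Y [set q]] feasible, so
    [odd_hollow_nonunit] applies to the pivot restricted to [W]. *)
Lemma DC_loopless_even n (C : 'M['F_2]_n) (Y W : {set 'I_n}) :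
  C^T = C -> Y \in DC C -> symdiff Y W \in DC C ->
  (forall q, q \in W -> symdiff Y [set q] \notin DC C) -> ~~ odd #|W|.
Proof.
move=> CT; rewrite !inE => YF; rewrite -pivot_unitmx // => WF loopless.
apply: contraL WF => W_odd; apply: odd_hollow_nonunit => // [|k].
  apply/matrixP => i j; rewrite mxE [LHS]mxE [RHS]mxE.
  by rewrite -[in LHS](pivot_sym CT YF) [LHS]mxE.
rewrite mxE; apply/eqP; apply: contraTT (enum_valP k) => /principal_unitmx1.
by rewrite pivot_unitmx // => qF; apply/negP => /loopless; rewrite inE qF.
Qed.

(* Transfer to binary delta-matroids, and the conclusion *)
Local Close Scope ring_scope.

(** The property is invariant under twisting, which only shifts [Y], and under relabelling by [f],
    so it reduces to [DC C]. *)
Lemma binary_loopless_even (E : finType) (F : {set {set E}}) (Y W : {set E}) :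
  is_binary F -> Y \in F -> symdiff Y W \in F ->
  (forall q, q \in W -> symdiff Y [set q] \notin F) -> ~~ odd #|W|.
Proof.
move=> [_ [A [n [C [CT [f [fB iso]]]]]]].
have fI := bij_inj fB.
have FE X : (X \in F) = (symdiff (f @: A) (f @: X) \in DC C).
  rewrite -imset_symdiff // -iso; apply/idP/imsetP => [XF|[Z ZF]]; first by exists X.
  by move/(congr1 (symdiff A)); rewrite !symdiffK => ->.
rewrite !FE imset_symdiff // symdiffA => YF YWF loopless.
rewrite -(card_imset _ fI); apply: (DC_loopless_even CT YF YWF).
move=> _ /imsetP [q qW ->].
by have := loopless q qW; rewrite FE imset_symdiff // imset_set1 symdiffA.
Qed.

Theorem theorem3 (E : finType) (F : {set {set E}}) (k : nat) :
  is_binary F ->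
  k \in twist_widths F -> k.+1 \in twist_widths F ->
  forall m : nat, (k + 2 <= m)%N -> (m <= max_twist_width F)%N ->
  m \in twist_widths F.
Proof.
move=> binF /existsP [A /eqP wA] /existsP [B /eqP wB] m km mM.
have [[F0 exchange] _] := binF.
have [X wX] : {X | max_twist_width F = width (twist F X)}.
  by apply: bigop.eq_bigmax; apply/card_gt0P; exists A.
apply/existsP; have [->|mne] := eqVneq m (width (twist F X)); first by exists X.
have noGap D := @width_twist_no_gap E F F0 exchange
  (fun Y W => @binary_loopless_even E F Y W binF) m D X.
suff [Z /eqP] : exists Z, width (twist F Z) = m by exists Z.
have mX : m < width (twist F X) by rewrite ltn_neqAle mne -wX.
(* One of [k] and [k.+1] has the parity of [m], and both lie below [m]. *)
have [oddm|oddm] := eqVneq (odd k) (odd m).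
  by apply: (noGap A) => //; lia.
by apply: (noGap B) => //; lia.
Qed.
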